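(* Let $m,n\ge 2$ be integers, let $t,\tilde t\in[0,+\infty)$ and let $k,\tilde k\geq 2$ be integers. Let $P_m$ be endowed with the metric $F_{t,k}$ and $P_n$ with the metric $\tilde F_{\tilde t,\tilde k}$. Then for every holomorphic mapping $f:P_m\to P_n$, $$\big(f^\ast \tilde F_{\tilde t,\tilde k}^2\big)(z;v)\le \frac{n+\tilde t\sqrt[\tilde k]{n}}{1+\tilde t}\,F_{t,k}^2(z;v),\qquad \forall z\in P_m,\ v\in T_z^{1,0}P_m .$$ Moreover, for any fixed $t,\tilde t\in[0,+\infty)$ and any fixed integers $k,\tilde k\ge 2$, the constant $\frac{n+\tilde t\sqrt[\tilde k]{n}}{1+\tilde t}$ is optimal, i.e. it cannot be replaced by any smaller constant for which the inequality holds for all holomorphic mappings $f:P_m\to P_n$, all $z\in P_m$ and all $v\in T^{1,0}_zP_m$.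
   Context: For an integer $d\ge1$, $P_d=\{z=(z^1,\dots,z^d)\in\mathbb C^d: |z^l|<1,\ l=1,\dots,d\}$ is the unit polydisc, and the holomorphic tangent space $T_z^{1,0}P_d$ is identified with $\mathbb C^d$. For $z\in P_m$, $v\in T_z^{1,0}P_m\cong\mathbb C^m$, $$F_{t,k}(z;v)=\frac{1}{\sqrt{1+t}}\sqrt{\sum_{l=1}^m\frac{|v^l|^2}{(1-|z^l|^2)^2}+t\sqrt[k]{\sum_{l=1}^m\frac{|v^l|^{2k}}{(1-|z^l|^2)^{2k}}}},$$ and for $\tilde z\in P_n$, $\tilde v\in T_{\tilde z}^{1,0}P_n\cong\mathbb C^n$, $$\tilde F_{\tilde t,\tilde k}(\tilde z;\tilde v)=\frac{1}{\sqrt{1+\tilde t}}\sqrt{\sum_{l=1}^n\frac{|\tilde v^l|^2}{(1-|\tilde z^l|^2)^2}+\tilde t\sqrt[\tilde k]{\sum_{l=1}^n\frac{|\tilde v^l|^{2\tilde k}}{(1-|\tilde z^l|^2)^{2\tilde k}}}}.$$ For a holomorphic mapping $f:P_m\to P_n$, the pull-back is $(f^\ast\tilde F_{\tilde t,\tilde k}^2)(z;v):=\tilde F_{\tilde t,\tilde k}^2(f(z);f_\ast(v))$, where $f_\ast$ is the (complex) differential of $f$ at $z$. *)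

(* Defs.v *)
(* MathComp-Analysis, with the complex numbers R[i] of mathcomp-real-closed. *)
From HB Require Import structures.
From mathcomp Require Import all_boot all_order all_algebra.
From mathcomp Require Export complex.
From mathcomp Require Import all_classical all_reals all_analysis.

Set Implicit Arguments.
Unset Strict Implicit.
Unset Printing Implicit Defensive.

Import Order.TTheory GRing.Theory Num.Theory.
Import numFieldNormedType.Exports.

Local Open Scope classical_set_scope.
Local Open Scope ring_scope.
Local Open Scope complex_scope.

(* The normed module structure of R[i] over itself, for the norm `|z|: without
   it, unification does not find a topology on the vectors 'rV[R[i]]_d. *)
HB.instance Definition _ (R : realType) := NormedModule.copy R[i] R[i]^o.

(* Real-valued modulus, whereas the ring norm `|z| of z : R[i] lies in R[i]. *)
Notation cmod := Normc.normc.

(* Only used for x >= 0 and k >= 1; powR gives 0 `^ k%:R^-1 = 0 there. *)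
Definition kth_root (R : realType) (k : nat) (x : R) : R := x `^ k%:R^-1.

Definition polydisc (R : realType) (d : nat) : set 'rV[R[i]]_d :=
  [set z | forall l : 'I_d, cmod (z ord0 l) < 1].

Definition polydisc_metric (R : realType) (d : nat) (t : R) (k : nat)
    (z v : 'rV[R[i]]_d) : R :=
  (Num.sqrt (1 + t))^-1 *
  Num.sqrt
    (\sum_(l < d) cmod (v ord0 l) ^+ 2 / (1 - cmod (z ord0 l) ^+ 2) ^+ 2 +
     t * kth_root k
       (\sum_(l < d) cmod (v ord0 l) ^+ (2 * k) /
                     (1 - cmod (z ord0 l) ^+ 2) ^+ (2 * k))).

(* A map P_m -> P_n is represented by a total function, of which only the
   values on P_m matter: P_m is open, so differentiability and the differential
   at its points ignore the other values. As 'rV[R[i]]_d is a normed module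
   over R[i], [differentiable] is complex differentiability and ['d f z] the
   C-linear differential. *)
Definition holomorphic_polydisc_map (R : realType) (m n : nat)
    (f : 'rV[R[i]]_m -> 'rV[R[i]]_n) : Prop :=
  (forall z : 'rV[R[i]]_m, polydisc z -> polydisc (f z)) /\
  (forall z : 'rV[R[i]]_m, polydisc z -> differentiable f z).

Definition pullback (R : realType) (m n : nat)
    (f : 'rV[R[i]]_m -> 'rV[R[i]]_n)
    (G : 'rV[R[i]]_n -> 'rV[R[i]]_n -> R) (z v : 'rV[R[i]]_m) : R :=
  G (f z) ('d f z v).

(* The inequality f^* F_{t',k'}^2 <= c F_{t,k}^2 for all holomorphic
   f : P_m -> P_n, at all points of P_m and all tangent vectors. *)
Definition schwarz_bound (R : realType) (m n : nat) (t t' : R) (k k' : nat)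
    (c : R) : Prop :=
  forall f : 'rV[R[i]]_m -> 'rV[R[i]]_n, holomorphic_polydisc_map f ->
  forall z v : 'rV[R[i]]_m, polydisc z ->
    pullback f (fun w u => polydisc_metric t' k' w u ^+ 2) z v
      <= c * polydisc_metric t k z v ^+ 2.

(* Main.v *)
(* The inequality reduces to |df_j(v)| / (1 - |f_j(z)|^2) <= M for each component
   f_j, where M = max_l |v^l| / (1 - |z^l|^2), because F_{t,k}(z; v) >= M while
   the target metric of a vector whose normalised entries are all at most M is
   at most sqrt((n + t' n^(1/k')) / (1 + t')) M. The component bound is the
   Schwarz-Pick lemma at 0 for f_j o phi, where phi(s)^l is the Moebius
   transformation sending 0 to z^l composed with a contraction, chosen so that
   phi'(0) = v / M. Equality holds at z = 0, v = e_1 for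
   f(z) = (z^1, ..., z^1).

   Schwarz's lemma is proved without Cauchy theory. For g : D -> D with
   g(0) = 0 put q(z) = g(z) / z. Goursat's bisection argument, in the form
   "a closed 1-form with merely differentiable coefficients has zero integral
   along rectangles", is applied to Im (q(e^w) dw) on [a, b] x [0, 2 pi] with
   a < b < 0. By periodicity the horizontal sides cancel, so the mean of Re q on
   the circle of radius e^x does not depend on x; it tends to Re g'(0) as
   x -> -oo and is at most e^-x. *)
From HB Require Import structures.
Require Import Defs.
From mathcomp Require Import all_boot all_order all_algebra.
From mathcomp Require Import all_classical all_reals all_analysis.
From mathcomp Require Import ring lra.

Set Implicit Arguments.
Unset Strict Implicit.
Unset Printing Implicit Defensive.

Import Order.TTheory GRing.Theory Num.Theory.
Import numFieldNormedType.Exports.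

Local Open Scope classical_set_scope.
Local Open Scope ring_scope.

(** * Integrals of closed forms along rectangles *)

Section integral.
Context {R : realType}.
Implicit Types (f g : R -> R) (a b c : R).

Definition itv_integral a b f : R :=
  \int[lebesgue_measure]_(x in `[a, b]) f x.

Lemma continuous_itv_integrable a b f :
  (forall x, a <= x <= b -> {for x, continuous f}) ->
  lebesgue_measure.-integrable `[a, b] (EFin \o f).
Proof.
move=> cf; apply: continuous_compact_integrable; first exact: segment_compact.
apply: continuous_in_subspaceT => x /set_mem; rewrite /= in_itv/=; exact: cf.
Qed.

Lemma itv_integral_split a b c f : a <= b <= c ->
  (forall x, a <= x <= c -> {for x, continuous f}) ->
  itv_integral a c f = itv_integral a b f + itv_integral b c f.
Proof.
move=> /andP[ab bc] cf; have fi := continuous_itv_integrable cf.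
have := @Rintegral_itvB R f (BLeft a) (BRight c) b fi.
rewrite !bnd_simp => /(_ ab bc).
rewrite Rintegral_itv_obnd_cbnd; last first.
  by apply: integrableS fi => //; apply: subset_itvr; rewrite bnd_simp.
by rewrite /itv_integral => <-; rewrite addrC subrK.
Qed.

Lemma itv_integralB a b f g :
  (forall x, a <= x <= b -> {for x, continuous f}) ->
  (forall x, a <= x <= b -> {for x, continuous g}) ->
  itv_integral a b (fun x => f x - g x) =
  itv_integral a b f - itv_integral a b g.
Proof.
move=> cf cg; rewrite /itv_integral RintegralB//;
  exact: continuous_itv_integrable.
Qed.

(** Measures how far a nearly constant integrand is from contributing its constant value. With
    [k = M = 0] it shows that an integral vanishes. *)
Lemma itv_integral_bounds a b f (k M : R) : a <= b ->
  (forall x, a <= x <= b -> {for x, continuous f}) ->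
  (forall x, a <= x <= b -> `|f x - k| <= M) ->
  `|itv_integral a b f - k * (b - a)| <= M * (b - a).
Proof.
move=> ab cf fk; have fi := continuous_itv_integrable cf.
have intc (r : R) : itv_integral a b (fun=> r) = r * (b - a).
  rewrite /itv_integral Rintegral_cst//; congr (_ * _).
  have /= -> := lebesgue_measure_itv `[a, b].
  by rewrite lte_fin; case: ltgtP ab => // -> _; rewrite subrr.
have ci (r : R) : lebesgue_measure.-integrable `[a, b] (EFin \o (fun=> r)).
  by apply: continuous_itv_integrable => x _; exact: cvg_cst.
have : itv_integral a b (fun=> k - M) <= itv_integral a b f.
  apply: le_Rintegral => // x; rewrite /= in_itv/= => /fk; rewrite ler_norml; lra.
have : itv_integral a b f <= itv_integral a b (fun=> k + M).
  apply: le_Rintegral => // x; rewrite /= in_itv/= => /fk; rewrite ler_norml; lra.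
rewrite !intc ler_norml; lra.
Qed.

End integral.

(** * Goursat's bisection argument for closed 1-forms *)

Section closed_form.
Context {R : realType}.
Implicit Types (P S : R -> R -> R).

(* P dx + S dy is closed at (x, y): S_x and P_y are both equal to q. *)
Definition closed_form_at P S (x y : R) : Prop :=
  exists p q s : R, forall e, 0 < e -> exists2 eta : R, 0 < eta &
    forall x' y', `|x' - x| <= eta -> `|y' - y| <= eta ->
      `|P x' y' - P x y - p * (x' - x) - q * (y' - y)|
        <= e * (`|x' - x| + `|y' - y|) /\
      `|S x' y' - S x y - q * (x' - x) - s * (y' - y)|
        <= e * (`|x' - x| + `|y' - y|).

(** The estimate bounds the increment by [(|p| + 1) |x' - x|] near [x]. *)
Lemma first_order_continuous (f : R -> R) (x p eta : R) : 0 < eta ->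
  (forall x', `|x' - x| <= eta -> `|f x' - f x - p * (x' - x)| <= `|x' - x|) ->
  {for x, continuous f}.
Proof.
move=> eta0 H; apply/cvgrPdist_le => e e0.
have p1 : 0 < `|p| + 1 by rewrite ltr_wpDl.
have nearx r : 0 < r -> \forall x' \near x, `|x' - x| <= r.
  by move=> r0; apply/nbhs_normP; exists r => // z /= /ltW; rewrite distrC.
near=> x'.
have h1 : `|x' - x| <= eta by near: x'; exact: nearx.
have h2 : `|x' - x| <= e / (`|p| + 1).
  by near: x'; apply: nearx; rewrite divr_gt0.
have h3 := H _ h1.
have h4 : `|p * (x' - x)| = `|p| * `|x' - x| by rewrite normrM.
rewrite distrC.
have -> : f x' - f x = (f x' - f x - p * (x' - x)) + p * (x' - x) by rewrite subrK.
apply: (le_trans (ler_normD _ _)); rewrite h4.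
move: h2; rewrite ler_pdivlMr//; lra.
Unshelve. all: by end_near. Qed.

Lemma closed_form_continuous_fst P S x y : closed_form_at P S x y ->
  {for x, continuous (P^~ y)}.
Proof.
move=> [p [q [s /(_ 1 ltr01)[eta eta0 H]]]].
apply: (@first_order_continuous _ x p eta) => // x' hx'.
have := H x' y hx'; rewrite subrr normr0 mulr0 subr0 addr0 mul1r.
by case/(_ (ltW eta0)) => h1 _; exact: h1.
Qed.

Lemma closed_form_continuous_snd P S x y : closed_form_at P S x y ->
  {for y, continuous (S x)}.
Proof.
move=> [p [q [s /(_ 1 ltr01)[eta eta0 H]]]].
apply: (@first_order_continuous _ y s eta) => // y' hy'.
have := H x y'; rewrite subrr normr0 !mulr0 !subr0 add0r mul1r.
by case/(_ (ltW eta0) hy') => _ h2; exact: h2.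
Qed.

(** The intervals [[u n, u n + w / 2 ^ n]] are nested, so the supremum of their left ends lies in
    all of them. *)
Lemma halving_limit (u : nat -> R) (w : R) : 0 <= w ->
  (forall n, u n <= u n.+1 <= u n + w / 2 ^+ n.+1) ->
  exists x, forall n, u n <= x <= u n + w / 2 ^+ n.
Proof.
move=> w0 H.
have half n : w / 2 ^+ n = w / 2 ^+ n.+1 + w / 2 ^+ n.+1.
  by rewrite exprS; field; rewrite expf_neq0.
(* Subtracting [w / 2 ^ (n + m)] makes the induction go through: it says that the right ends
   decrease. *)
have up n m : u n <= u (n + m)%N <= u n + w / 2 ^+ n - w / 2 ^+ (n + m).
  elim: m => [|m]; first by rewrite addn0; lra.
  by rewrite addnS; move: (H (n + m)%N) (half (n + m)%N); lra.
have wn n : 0 <= w / 2 ^+ n by rewrite divr_ge0// exprn_ge0.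
have ub n m : u m <= u n + w / 2 ^+ n.
  case: (leqP n m) => [|/ltnW] /subnKC <-.
    by move: (up n (m - n)%N) (wn (n + (m - n))%N); lra.
  by move: (up m (n - m)%N) (wn (m + (n - m))%N); lra.
exists (sup (range u)) => n; apply/andP; split.
  apply: sup_upper_bound; last by exists n.
  split; first by exists (u 0%N), 0%N.
  by exists (u 0%N + w / 2 ^+ 0) => _ [m _ <-]; exact: ub.
by apply: ge_sup; [exists (u 0%N), 0%N|move=> _ [m _ <-]; exact: ub].
Qed.

(** [good n x y] stands for a property of the rectangle with lower left corner [(x, y)] and sides
    [w / 2 ^ n], [h / 2 ^ n]. A bad rectangle has a bad quarter, and the nested bad rectangles
    chosen in this way share a point. *)
Lemma quadrisection (good : nat -> R -> R -> Prop) (w h a c : R) :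
  0 <= w -> 0 <= h ->
  (forall n x y, good n.+1 x y -> good n.+1 (x + w / 2 ^+ n.+1) y ->
     good n.+1 x (y + h / 2 ^+ n.+1) ->
     good n.+1 (x + w / 2 ^+ n.+1) (y + h / 2 ^+ n.+1) -> good n x y) ->
  ~ good 0%N a c ->
  exists x y, forall n, exists u v, [/\ ~ good n u v,
    u <= x <= u + w / 2 ^+ n & v <= y <= v + h / 2 ^+ n].
Proof.
move=> w0 h0 quarter bad.
have wn n : 0 <= w / 2 ^+ n by rewrite divr_ge0// exprn_ge0.
have hn n : 0 <= h / 2 ^+ n by rewrite divr_ge0// exprn_ge0.
(* Badness is a premise inside the existential, so that [choice] yields a total successor
   function. *)
have step (np : nat * (R * R)) : exists p' : R * R,
    ~ good np.1 np.2.1 np.2.2 -> [/\ ~ good np.1.+1 p'.1 p'.2,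
     np.2.1 <= p'.1 <= np.2.1 + w / 2 ^+ np.1.+1 &
     np.2.2 <= p'.2 <= np.2.2 + h / 2 ^+ np.1.+1].
  case: np => n [x y] /=; apply/not_existsP => no.
  have all4 x' y' : x <= x' <= x + w / 2 ^+ n.+1 ->
      y <= y' <= y + h / 2 ^+ n.+1 -> good n.+1 x' y'.
    move=> hx hy; apply: contrapT => g.
    by apply: (no (x', y')) => _.
  apply: (no (x, y)) => -[]; apply: quarter; apply: all4;
    move: (wn n.+1) (hn n.+1); lra.
have [next nextP] := choice step.
pose z := fix z n := if n is n'.+1 then next (n', z n') else (a, c).
have zb n : ~ good n (z n).1 (z n).2.
  by elim: n => [//|n IH]; case: (nextP (n, z n) IH).
have [x xP] : exists x, forall n, (z n).1 <= x <= (z n).1 + w / 2 ^+ n.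
  by apply: halving_limit => // n; case: (nextP (n, z n) (zb n)).
have [y yP] : exists y, forall n, (z n).2 <= y <= (z n).2 + h / 2 ^+ n.
  by apply: halving_limit => // n; case: (nextP (n, z n) (zb n)).
by exists x, y => n; exists (z n).1, (z n).2; split.
Qed.

(** The counterclockwise integral of P dx + S dy along the boundary of [a, b] x [c, d], with
    opposite sides merged into one integral. *)
Definition rect_circulation P S (a b c d : R) : R :=
  itv_integral a b (fun x => P x c - P x d) +
  itv_integral c d (fun y => S b y - S a y).

Section rectangle.
Variables (P S : R -> R -> R) (a0 b0 c0 d0 : R).
Hypothesis closedPS : forall x y, a0 <= x <= b0 -> c0 <= y <= d0 ->
  closed_form_at P S x y.

Let contP y x : a0 <= x <= b0 -> c0 <= y <= d0 -> {for x, continuous (P^~ y)}.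
Proof. by move=> hx hy; apply: closed_form_continuous_fst (closedPS hx hy). Qed.

Let contS x y : a0 <= x <= b0 -> c0 <= y <= d0 -> {for y, continuous (S x)}.
Proof. by move=> hx hy; apply: closed_form_continuous_snd (closedPS hx hy). Qed.

(** Each inner side is traversed twice, in opposite directions. *)
Lemma rect_circulation_quarters a xm b c ym d :
  a0 <= a -> a <= xm <= b -> b <= b0 -> c0 <= c -> c <= ym <= d -> d <= d0 ->
  rect_circulation P S a b c d =
  rect_circulation P S a xm c ym + rect_circulation P S xm b c ym +
  rect_circulation P S a xm ym d + rect_circulation P S xm b ym d.
Proof.
move=> ha hx hb hc hy hd; rewrite /rect_circulation.
rewrite !itv_integralB; try by move=> z hz; (apply: contP || apply: contS); lra.
rewrite !(@itv_integral_split _ a xm b)//;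
  try by move=> z hz; (apply: contP); lra.
rewrite !(@itv_integral_split _ c ym d)//;
  try by move=> z hz; (apply: contS); lra.
ring.
Qed.

(* Each integrand is a difference across the rectangle, so it is nearly constant,
   equal to - q (d - c) resp. q (b - a), and these contributions cancel. *)
Lemma rect_circulation_local x y e : a0 <= x <= b0 -> c0 <= y <= d0 -> 0 < e ->
  exists2 eta : R, 0 < eta & forall a b c d,
    a0 <= a -> b <= b0 -> c0 <= c -> d <= d0 ->
    a <= x <= b -> c <= y <= d -> b - a <= eta -> d - c <= eta ->
    `|rect_circulation P S a b c d| <= e * (b - a + (d - c)) ^+ 2.
Proof.
(* Half of [e], because each integrand is a difference of two values and each carries the error. *)
move=> hx hy e0; have [p [q [s /(_ (e / 2))]]] := closedPS hx hy.
case=> [|eta eta0 H]; first by rewrite divr_gt0.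
exists eta => // a b c d ha hb hc hd hxab hycd hw hh.
set W := b - a in hw *; set h := d - c in hh *.
have bd x' y' : a <= x' <= b -> c <= y' <= d ->
   `|P x' y' - P x y - p * (x' - x) - q * (y' - y)| <= e / 2 * (W + h) /\
   `|S x' y' - S x y - q * (x' - x) - s * (y' - y)| <= e / 2 * (W + h).
  move=> hx' hy'.
  have hX : `|x' - x| <= W by rewrite ler_norml /W; lra.
  have hY : `|y' - y| <= h by rewrite ler_norml /h; lra.
  have [h1 h2] := H x' y' (le_trans hX hw) (le_trans hY hh).
  by split; [apply: le_trans h1 _|apply: le_trans h2 _];
    rewrite ler_wpM2l ?lerD//; apply/ltW; rewrite divr_gt0.
have I1 : `|itv_integral a b (fun x => P x c - P x d) - (- q * h) * W|
    <= e * (W + h) * W.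
  apply: itv_integral_bounds => [|z hz|z hz]; first by lra.
    by apply: continuousB; apply: contP; lra.
  have [+ _] := bd z c hz ltac:(lra); have [+ _] := bd z d hz ltac:(lra).
  by rewrite !ler_norml /W /h; lra.
have I2 : `|itv_integral c d (fun y => S b y - S a y) - (q * W) * h|
    <= e * (W + h) * h.
  apply: itv_integral_bounds => [|z hz|z hz]; first by lra.
    by apply: continuousB; apply: contS; lra.
  have [_ +] := bd b z ltac:(lra) hz; have [_ +] := bd a z ltac:(lra) hz.
  by rewrite !ler_norml /W /h; lra.
rewrite /rect_circulation.
move: I1 I2; rewrite !ler_norml; set i1 := itv_integral _ _ _; set i2 := itv_integral _ _ _.
have -> : e * (W + h) ^+ 2 = e * (W + h) * W + e * (W + h) * h by ring.
have -> : - q * h * W = - (q * W * h) by ring.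
lra.
Qed.

(** If the bound [e (w + h) ^ 2] failed, quadrisection would give arbitrarily small rectangles
    around one point on which it fails in proportion, against [rect_circulation_local]. *)
Lemma closed_form_rectangle : a0 <= b0 -> c0 <= d0 ->
  rect_circulation P S a0 b0 c0 d0 = 0.
Proof.
move=> ab cd; set w := b0 - a0; set h := d0 - c0.
have w0 : 0 <= w by rewrite subr_ge0.
have h0 : 0 <= h by rewrite subr_ge0.
have wn n : 0 <= w / 2 ^+ n by rewrite divr_ge0// exprn_ge0.
have hn n : 0 <= h / 2 ^+ n by rewrite divr_ge0// exprn_ge0.
have half (v : R) n : v / 2 ^+ n = v / 2 ^+ n.+1 + v / 2 ^+ n.+1.
  by rewrite exprS; field; rewrite expf_neq0.
suff small e : 0 < e -> `|rect_circulation P S a0 b0 c0 d0| <= e * (w + h) ^+ 2.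
  apply/eqP; rewrite -normr_eq0 eq_le normr_ge0 andbT.
  apply/ler_addgt0Pl => e e0; rewrite addr0.
  (* The summand 1 keeps the divisor positive when the rectangle degenerates to a point. *)
  have K : 0 < (w + h) ^+ 2 + 1 by rewrite ltr_wpDl// sqr_ge0.
  apply: le_trans (small (e / ((w + h) ^+ 2 + 1)) _) _; first by rewrite divr_gt0.
  rewrite mulrAC ler_pdivrMr// ler_wpM2l ?ltW// ltrDl//.
move=> e0.
(* Containment in the large rectangle is a premise, so the negation of [good] provides it. *)
pose good n x y := a0 <= x -> x + w / 2 ^+ n <= b0 ->
  c0 <= y -> y + h / 2 ^+ n <= d0 ->
  `|rect_circulation P S x (x + w / 2 ^+ n) y (y + h / 2 ^+ n)|
    <= e * (w / 2 ^+ n + h / 2 ^+ n) ^+ 2.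
suff : good 0%N a0 c0.
  rewrite /good expr0 !divr1.
  have -> : a0 + w = b0 by rewrite addrC subrK.
  have -> : c0 + h = d0 by rewrite addrC subrK.
  exact.
apply: contrapT => /(@quadrisection good w h a0 c0 w0 h0)[].
  move=> n x y g1 g2 g3 g4 hx1 hx2 hy1 hy2.
  have W := wn n.+1; have H := hn n.+1.
  move: g1 g2 g3 g4; rewrite /good.
  move: hx2 hy2; rewrite (half w n) (half h n).
  set w' := w / _ in W *; set h' := h / _ in H * => hx2 hy2.
  move=> /(_ hx1 ltac:(lra) hy1 ltac:(lra)) g1.
  move=> /(_ ltac:(lra) ltac:(lra) hy1 ltac:(lra)) g2.
  move=> /(_ hx1 ltac:(lra) ltac:(lra) ltac:(lra)) g3.
  move=> /(_ ltac:(lra) ltac:(lra) ltac:(lra) ltac:(lra)) g4.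
  rewrite !addrA (@rect_circulation_quarters _ (x + w') _ _ (y + h'));
    try lra.
  apply: (le_trans (ler_normD _ _)).
  (* Halving the sides divides the square by 4, which matches the four quarters exactly. *)
  have -> : (w' + w' + h' + h') ^+ 2 = 4 * (w' + h') ^+ 2 by ring.
  rewrite mulrCA.
  have := ler_normD (rect_circulation P S x (x + w') y (y + h') +
    rect_circulation P S (x + w') (x + w' + w') y (y + h'))
    (rect_circulation P S x (x + w') (y + h') (y + h' + h')).
  have := ler_normD (rect_circulation P S x (x + w') y (y + h'))
    (rect_circulation P S (x + w') (x + w' + w') y (y + h')).
  lra.
move=> x [y xyP].
have [u [v [+ hu hv]]] := xyP 0%N.
rewrite /good expr0 !divr1 => /not_implyP[u1 /not_implyP[u2 /not_implyP[v1 /not_implyP[v2 _]]]].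
move: hu hv; rewrite expr0 !divr1 => hu hv.
have [eta eta0 H] := @rect_circulation_local x y e ltac:(lra) ltac:(lra) e0.
(* Then [(w + h) / eta < n < 2 ^ n], so both sides of the n-th rectangle are at most [eta]. *)
pose n := Num.bound ((w + h) / eta).
have hN : w / 2 ^+ n + h / 2 ^+ n <= eta.
  have : (w + h) / eta < n%:R.
    by apply: archi_boundP; apply: divr_ge0; [exact: addr_ge0|exact: ltW].
  rewrite ltr_pdivrMr// => /ltW le1.
  rewrite -mulrDl ler_pdivrMr ?exprn_gt0//; apply: (le_trans le1).
  rewrite mulrC ler_wpM2l ?ltW// -natrX ltr_nat ltn_expl//.
move: hN (wn n) (hn n) (xyP n) => hN W0 H0 [u' [v' [+ hu' hv']]].
rewrite /good => /not_implyP[? /not_implyP[? /not_implyP[? /not_implyP[?]]]].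
have := H u' (u' + w / 2 ^+ n) v' (v' + h / 2 ^+ n).
have -> z1 z2 : z1 + z2 - z1 = z2 :> R by ring.
have -> z1 z2 : z1 + z2 - z1 = z2 :> R by ring.
by move=> H'; apply; apply: H' => //; lra.
Qed.

End rectangle.
End closed_form.

(** * The complex exponential *)

Section complex_modulus.
Context {R : realType}.
Local Open Scope complex_scope.
Implicit Types (z w : R[i]) (x : R).

Lemma normrcE z : `|z| = (cmod z)%:C.
Proof. by case: z. Qed.

Lemma cmod_ge0 z : 0 <= cmod z.
Proof. by case: z => a b; exact: sqrtr_ge0. Qed.

Lemma sqr_cmod z : cmod z ^+ 2 = complex.Re z ^+ 2 + complex.Im z ^+ 2.
Proof. by case: z => a b; rewrite /= sqr_sqrtr// addr_ge0// sqr_ge0. Qed.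

Lemma cmod_eq0 z : (cmod z == 0) = (z == 0).
Proof.
by apply/eqP/eqP => [|->]; [exact: Normc.eq0_normc|exact: Normc.normc0].
Qed.

Lemma cmodC x : cmod x%:C = `|x|.
Proof. by rewrite /= expr0n addr0 sqrtr_sqr. Qed.

Lemma ge_cmod_Re z : `|complex.Re z| <= cmod z.
Proof. by rewrite -lecR -normrcE normc_ge_Re. Qed.

Lemma ge_cmod_Im z : `|complex.Im z| <= cmod z.
Proof.
rewrite -[leRHS]ger0_norm ?cmod_ge0// -ler_sqr ?qualifE/= ?normr_ge0//.
by rewrite !real_normK ?num_real// sqr_cmod lerDr sqr_ge0.
Qed.

Lemma le_cmod_ReIm z : cmod z <= `|complex.Re z| + `|complex.Im z|.
Proof.
rewrite -ler_sqr ?qualifE/= ?addr_ge0 ?cmod_ge0// sqr_cmod sqrrD !real_normK ?num_real//.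
by rewrite addrAC lerDl mulrn_wge0// mulr_ge0.
Qed.

End complex_modulus.

Section first_order.
Local Open Scope complex_scope.

Lemma derivable_first_order (K : numFieldType) (f : K -> K) (z : K) :
  derivable f z 1 -> forall e : K, 0 < e -> exists2 eta : K, 0 < eta &
    forall h, `|h| <= eta -> `|f (z + h) - f z - 'D_1 f z * h| <= e * `|h|.
Proof.
move=> df e e0; have /cvgrPdist_le/(_ _ e0) := df; rewrite near_withinE.
move=> /nbhs_normP[d /= d0 H].
exists (d / 2) => [|h hd]; first by rewrite divr_gt0.
have [->|h0] := eqVneq h 0.
  by rewrite addr0 subrr mulr0 subrr normr0 mulr0.
have := H h; rewrite /= sub0r normrN => /(_ _ h0).
rewrite (le_lt_trans hd) ?ltr_pdivrMr ?ltr_pMr ?ltr1n// => /(_ isT).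
rewrite scaler1 => H'.
have -> : f (z + h) - f z - 'D_1 f z * h =
    - (('D_1 f z - h^-1 * (f (h + z) - f z)) * h).
  by rewrite [z + h]addrC; field.
by rewrite normrN normrM ler_wpM2r.
Qed.

Lemma complex_first_order (R : realType) (f : R[i] -> R[i]) (z : R[i]) :
  derivable f z 1 -> forall e : R, 0 < e -> exists2 eta : R, 0 < eta &
    forall h, cmod h <= eta -> cmod (f (z + h) - f z - 'D_1 f z * h) <= e * cmod h.
Proof.
move=> df e e0; have e0C : 0 < e%:C by rewrite ltcR.
have [d d0 H] := derivable_first_order df e0C.
(* A positive element of [R[i]] is real, so its real part serves as the radius. *)
have dE : d = (complex.Re d)%:C by rewrite RRe_real// gtr0_real.
exists (complex.Re d); first by move: d0; rewrite {1}dE ltcR.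
move=> h hd; have := H h; rewrite dE !normrcE -rmorphM/= !lecR; exact.
Qed.

End first_order.

Section complex_exponential.
Context {R : realType}.
Local Open Scope complex_scope.
Implicit Types x y : R.

(** The exponential of x + iy; the two real coordinates are separate arguments because the closed
    form is written in them. *)
Definition cexp x y : R[i] := (expR x * cos y) +i* (expR x * sin y).

Lemma cexpD x y x' y' : cexp (x + x') (y + y') = cexp x y * cexp x' y'.
Proof.
by apply/eqP; rewrite eq_complex /= expRD cosD sinD; apply/andP; split;
  apply/eqP; ring.
Qed.

Lemma cmod_cexp x y : cmod (cexp x y) = expR x.
Proof.
by rewrite /cexp/= !exprMn -mulrDr cos2Dsin2 mulr1 sqrtr_sqr ger0_norm//.
Qed.

Lemma cexp_neq0 x y : cexp x y != 0.
Proof. by rewrite -cmod_eq0 cmod_cexp gt_eqF// expR_gt0. Qed.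

Lemma cexp0_first_order (e : R) : 0 < e -> exists2 eta : R, 0 < eta &
  forall u v, `|u| <= eta -> `|v| <= eta ->
    cmod (cexp u v - 1 - (u +i* v)) <= e * (`|u| + `|v|).
Proof.
(* The four error terms below add up to at most [4 e1 (|u| + |v|)]; [e1 <= 1] also gives
   [|de| <= |u|] and [|ds| <= |v|]. *)
move=> e0; pose e1 : R := Num.min 1 (e / 4).
have e10 : 0 < e1 by rewrite lt_min ltr01 divr_gt0.
have e11 : e1 <= 1 by rewrite ge_min lexx.
have e1e : 4 * e1 <= e by rewrite mulrC -ler_pdivlMr// ge_min lexx orbT.
have [a a0] := @derivable_first_order R expR 0 (@derivable_expR R 0) e1 e10.
have [b b0] := @derivable_first_order R cos 0 (@derivable_cos R 0) e1 e10.
have [c c0] := @derivable_first_order R sin 0 (@derivable_sin R 0) e1 e10.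
rewrite !derive_val cos0 sin0 expR0 !oppr0 => Hs Hc He.
(* [|u| <= e1 / 4] turns the second-order product exp(u) - 1 times sin v into an error of at most
   [e1 |v|]. *)
pose eta := Num.min (Num.min a b) (Num.min c (e1 / 4)).
exists eta; first by rewrite !lt_min a0 b0 c0 divr_gt0.
move=> u v; rewrite !le_min => /andP[/andP[ua _] /andP[_ u4]].
move=> /andP[/andP[_ vb] /andP[vc _]].
have := He u ua; have := Hc v vb; have := Hs v vc.
rewrite !add0r mul0r !(subr0, addr0) !mul1r => hs hc he.
apply: (le_trans (le_cmod_ReIm _)).
rewrite /cexp/=.
have -> : expR u * cos v - 1 - u =
    (expR u - 1 - u) * cos v + (1 + u) * (cos v - 1) by ring.
have -> : expR u * sin v - 0 - v =
    ((expR u - 1 - u) + u) * ((sin v - v) + v) + (sin v - v) by ring.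
move: hs hc he; set ds := sin v - v; set dc := cos v - 1; set de := expR u - 1 - u.
move=> hs hc he.
have cv : `|cos v| <= 1 by rewrite ler_norml cos_geN1 cos_le1.
have h1 : `|de * cos v| <= e1 * `|u|.
  by rewrite normrM -[leRHS]mulr1 ler_pM.
have h2 : `|(1 + u) * dc| <= 2 * (e1 * `|v|).
  rewrite normrM ler_pM//; apply: (le_trans (ler_normD _ _)); rewrite normr1; lra.
have h3 : `|(de + u) * (ds + v)| <= (2 * (e1 / 4)) * (2 * `|v|).
  have e1u : e1 * `|u| <= `|u| by rewrite ler_piMl.
  have e1v : e1 * `|v| <= `|v| by rewrite ler_piMl.
  rewrite normrM ler_pM//; apply: (le_trans (ler_normD _ _)); lra.
have := ler_normD (de * cos v) ((1 + u) * dc).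
have := ler_normD ((de + u) * (ds + v)) ds.
have h4 : 4 * e1 * (`|u| + `|v|) <= e * (`|u| + `|v|) by rewrite ler_wpM2r// addr_ge0.
have : 0 <= e1 * `|u| by rewrite mulr_ge0// ltW.
lra.
Qed.

(** The functional equation transports the expansion at 0, at the cost of the factor [expR x]. *)
Lemma cexp_first_order x y (e : R) : 0 < e -> exists2 eta : R, 0 < eta &
  forall x' y', `|x' - x| <= eta -> `|y' - y| <= eta ->
    cmod (cexp x' y' - cexp x y - cexp x y * ((x' - x) +i* (y' - y)))
      <= e * (`|x' - x| + `|y' - y|).
Proof.
move=> e0; have ex0 := expR_gt0 x.
have [|eta eta0 H] := @cexp0_first_order (e / expR x); first by rewrite divr_gt0.
exists eta => // x' y' hx hy.
have -> : cexp x' y' = cexp x y * cexp (x' - x) (y' - y).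
  by rewrite -cexpD; congr cexp; ring.
set d := _ +i* _.
have -> : cexp x y * cexp (x' - x) (y' - y) - cexp x y - cexp x y * d =
   cexp x y * (cexp (x' - x) (y' - y) - 1 - d) by ring.
rewrite Normc.normcM cmod_cexp.
have := H _ _ hx hy; rewrite -(ler_pM2l ex0) => /le_trans; apply.
by rewrite mulrA mulrCA divff ?gt_eqF// mulr1.
Qed.

(* Im (Q dw) = Im Q dx + Re Q dy for Q w = q (exp w) *)
Lemma closed_form_exp (q : R[i] -> R[i]) x y : derivable q (cexp x y) 1 ->
  closed_form_at (fun x y => complex.Im (q (cexp x y)))
                 (fun x y => complex.Re (q (cexp x y))) x y.
Proof.
move=> dq; set z := cexp x y; set D := 'D_1 q z * z.
(* [D] is the derivative of q o exp at x + iy. The coefficients are those of dx and dy in Im (D dw)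
   and Re (D dw), and the shared one is a Cauchy-Riemann equation. *)
exists (complex.Im D), (complex.Re D), (- complex.Im D) => e e0.
(* [A] bounds the increment of exp relative to [N], and [B] dominates the derivative of [q]. The
   error of [q] and that of exp each get [e / 2 * N]. *)
pose A := cmod z + 1; pose B := cmod ('D_1 q z) + 1.
have A0 : 0 < A by rewrite ltr_wpDl// cmod_ge0.
have B0 : 0 < B by rewrite ltr_wpDl// cmod_ge0.
have [|d d0 Hq] := complex_first_order dq (_ : 0 < e / 2 / A).
  by rewrite !divr_gt0.
pose e2 := Num.min 1 (e / 2 / B).
have e20 : 0 < e2 by rewrite lt_min ltr01 !divr_gt0.
have e21 : e2 <= 1 by rewrite ge_min lexx.
have e2B : e2 * B <= e / 2 by rewrite -ler_pdivlMr// ge_min lexx orbT.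
have [eta eta0 Hz] := @cexp_first_order x y e2 e20.
exists (Num.min eta (d / 2 / A)); first by rewrite lt_min eta0 !divr_gt0.
move=> x' y'; rewrite !le_min => /andP[hx hx'] /andP[hy hy'].
have := Hz _ _ hx hy; rewrite -/z; set w := _ +i* _; set N := _ + `|_| => h1.
have N0 : 0 <= N by rewrite addr_ge0.
have wN : cmod w <= N by exact: le_cmod_ReIm.
set k := cexp x' y' - z.
have kN : cmod k <= A * N.
  have -> : k = (k - z * w) + z * w by ring.
  apply: (le_trans (le_normcD _ _)); rewrite Normc.normcM.
  have : cmod z * cmod w <= cmod z * N by rewrite ler_wpM2l ?cmod_ge0.
  have : e2 * N <= N by rewrite ler_piMl.
  by rewrite /A mulrDl mul1r; move: h1; rewrite -/k; lra.
have ANd : A * N <= d.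
  have : N <= d / A by move: hx' hy'; rewrite /N mulrAC; lra.
  by rewrite ler_pdivlMr// mulrC.
have := Hq k (le_trans kN ANd).
have -> : z + k = cexp x' y' by rewrite /k; ring.
rewrite -/z => h2.
have : cmod (q (cexp x' y') - q z - D * w) <= e * N.
  have -> : q (cexp x' y') - q z - D * w =
    (q (cexp x' y') - q z - 'D_1 q z * k) + 'D_1 q z * (k - z * w).
    by rewrite /D; ring.
  apply: (le_trans (le_normcD _ _)); rewrite Normc.normcM.
  have h3 : e / 2 / A * cmod k <= e / 2 * N.
    rewrite mulrAC ler_pdivrMr// -[leRHS]mulrA ler_wpM2l ?(mulrC N)//.
    by rewrite divr_ge0// ltW.
  have h4 : cmod ('D_1 q z) * cmod (k - z * w) <= B * (e2 * N).
    by rewrite ler_pM ?cmod_ge0// /B lerDl.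
  have h5 : B * (e2 * N) <= e / 2 * N by rewrite mulrA ler_wpM2r// mulrC.
  lra.
move: (q (cexp x' y')) (q z) D => [a1 a2] [b1 b2] [D1 D2] H.
have hI := le_trans (ge_cmod_Im _) H; have hR := le_trans (ge_cmod_Re _) H.
split; [move: hI|move: hR]; rewrite /w /=; apply: le_trans;
 rewrite le_eqVlt; apply/orP; left; apply/eqP; congr `|_|; ring.
Qed.

End complex_exponential.

(** * The Schwarz lemma *)

Section schwarz.
Context {R : realType}.
Local Open Scope complex_scope.
Implicit Type g : R[i] -> R[i].

(** Two fixed circles replace the limits: if [d > 1], the values of Re q on a small circle and on
    one close to the unit circle are too far apart to have the same mean. *)
Lemma schwarz_Re_derive g : (forall z, cmod z < 1 -> derivable g z 1) ->
  (forall z, cmod z < 1 -> cmod (g z) < 1) -> g 0 = 0 ->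
  complex.Re ('D_1 g 0) <= 1.
Proof.
move=> dg g1 g0; rewrite leNgt; apply/negP => d1.
(* With [d = 1 + 4 k], Re q is at most [1 + k] on the outer circle and at least [d - k = 1 + 3 k] on
   the inner one. *)
set d := complex.Re _ in d1; pose k := (d - 1) / 4.
have k0 : 0 < k by rewrite divr_gt0// subr_gt0.
(* The outer radius is 1 / (1 + k), so [|q| = |g| / |z|] is at most [1 + k] there. *)
pose b := - ln (1 + k).
have k1 : 0 < 1 + k by rewrite addr_gt0.
have b0 : b < 0 by rewrite oppr_lt0 ln_gt0// ltrDl.
have eb : expR b = (1 + k)^-1 by rewrite expRN lnK.
have dg0 : derivable g 0 1 by apply: dg; rewrite Normc.normc0.
have [eta eta0 Hg] := complex_first_order dg0 k0.
(* The inner radius is at most [eta], where the expansion of [g] at 0 keeps [q] within [k] of its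
   derivative at 0. *)
pose a := Num.min b (ln eta).
have ab : a <= b by rewrite ge_min lexx.
have aeta : expR a <= eta by rewrite -[leRHS]lnK// ler_expR ge_min lexx orbT.
pose q z := g z / z.
pose P x y := complex.Im (q (cexp x y)); pose S x y := complex.Re (q (cexp x y)).
have PS x y : x <= b -> closed_form_at P S x y.
  move=> xb; apply: closed_form_exp.
  apply: derivableM; first by apply: dg; rewrite cmod_cexp expR_lt1 (le_lt_trans xb).
  by apply: (@derivableV _ _ id); [exact: cexp_neq0|exact: derivable_id].
have pi20 : 0 <= pi *+ 2 :> R by rewrite mulrn_wge0// ltW// pi_gt0.
have Sb y : `|S b y| <= 1 + k.
  apply: (le_trans (ge_cmod_Re _)); rewrite Normc.normcM Normc.normcV cmod_cexp eb invrK.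
  rewrite -[leRHS]mul1r ler_wpM2r ?ltW//; apply: g1.
  by rewrite cmod_cexp expR_lt1.
have Sa y : `|S a y - d| <= k.
  have -> : S a y - d = complex.Re (q (cexp a y) - 'D_1 g 0) by rewrite raddfB.
  apply: (le_trans (ge_cmod_Re _)).
  have := Hg (cexp a y); rewrite cmod_cexp add0r g0 subr0 => /(_ aeta).
  have -> : g (cexp a y) - 'D_1 g 0 * cexp a y = (q (cexp a y) - 'D_1 g 0) * cexp a y.
    by rewrite mulrBl divfK// cexp_neq0.
  by rewrite Normc.normcM cmod_cexp ler_pM2r// expR_gt0.
have circ : rect_circulation P S a b 0 (pi *+ 2) = 0.
  by apply: closed_form_rectangle => // x y /andP[_ xb] _; exact: PS.
(* The sides y = 0 and y = 2 pi cancel by periodicity. *)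
have I1 : `|itv_integral a b (fun x => P x 0 - P x (pi *+ 2)) - 0 * (b - a)|
    <= 0 * (b - a).
  apply: itv_integral_bounds => // x /andP[_ xb].
    by apply: continuousB; apply: closed_form_continuous_fst; apply: PS.
  by rewrite /P /cexp cos0 sin0 cos2pi sin2pi subrr subr0 normr0.
have I2 : `|itv_integral 0 (pi *+ 2) (fun y => S b y - S a y) -
    (- d) * (pi *+ 2 - 0)| <= (1 + 2 * k) * (pi *+ 2 - 0).
  apply: itv_integral_bounds => // y _.
    by apply: continuousB; apply: closed_form_continuous_snd; apply: PS.
  by move: (Sb y) (Sa y); rewrite !ler_norml; lra.
move: I1; rewrite !mul0r subr0 normr_le0 => /eqP I1.
move: circ; rewrite /rect_circulation I1 add0r => I0.
move: I2; rewrite I0 !subr0 sub0r mulNr opprK ler_norml => /andP[_].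
have pi20' : 0 < pi *+ 2 :> R by rewrite mulrn_wgt0// pi_gt0.
by rewrite ler_pM2r// /k; lra.
Qed.

(** Multiplying [g] by a unimodular [u] makes the derivative at 0 real and equal to its modulus. *)
Lemma schwarz_derive0 g : (forall z, cmod z < 1 -> derivable g z 1) ->
  (forall z, cmod z < 1 -> cmod (g z) < 1) -> g 0 = 0 ->
  cmod ('D_1 g 0) <= 1.
Proof.
move=> dg g1 g0; set d := 'D_1 g 0.
have [->|dn0] := eqVneq d 0; first by rewrite Normc.normc0.
have dc0 : cmod d != 0 by rewrite cmod_eq0.
have dg0 : derivable g 0 1 by apply: dg; rewrite Normc.normc0.
pose u : R[i] := (cmod d)%:C / d.
have cu : cmod u = 1.
  by rewrite Normc.normcM Normc.normcV cmodC ger0_norm ?cmod_ge0// divff.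
have := @schwarz_Re_derive (u \*o g).
rewrite deriveMl// -/d {1}/u divfK//; apply.
- move=> z z1; apply: (@derivableM _ _ (cst u) g) (derivable_cst _ _ _) _.
  exact: dg.
- by move=> z z1; rewrite Normc.normcM cu mul1r g1.
- by rewrite /= g0 mulr0.
Qed.

End schwarz.

(** * The Schwarz-Pick lemma on the polydisc *)

Section chain_rule.
Variable K : numFieldType.

Lemma derivable_comp (f g : K -> K) (z : K) :
  derivable g z 1 -> derivable f (g z) 1 -> derivable (f \o g) z 1.
Proof.
move=> /derivable1_diffP dg /derivable1_diffP df.
by apply/derivable1_diffP; exact: differentiable_comp.
Qed.

Lemma derive_comp (f g : K -> K) (z : K) :
  derivable g z 1 -> derivable f (g z) 1 ->
  'D_1 (f \o g) z = 'D_1 f (g z) * 'D_1 g z.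
Proof.
move=> /derivable1_diffP dg /derivable1_diffP df; rewrite -!derive1E.
rewrite derive1E'; last exact: differentiable_comp.
rewrite (diff_comp dg df) (derive1E' dg) (derive1E' df) /=.
by rewrite -[X in 'd  _ _ X = _]mulr1 [LHS]linearZ mulrC.
Qed.

(** The row is a sum of scalar functions times fixed basis rows, so the rules for sums and scalings
    apply. *)
Lemma diff_row m (k : 'I_m -> K -> K) (z : K) :
  (forall l, derivable (k l) z 1) ->
  differentiable (fun s => \row_l k l s : 'rV[K]_m) z /\
  'd (fun s => \row_l k l s : 'rV[K]_m) z 1 = \row_l 'D_1 (k l) z.
Proof.
move=> dk.
have -> : (fun s => \row_l k l s) =
    \sum_(l < m) (fun s => k l s *: delta_mx 0 l) :> (K -> 'rV[K]_m).
  apply/funext => s; rewrite fct_sumE [LHS]row_sum_delta.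
  by apply: eq_bigr => l _; rewrite mxE.
have dkd l : differentiable (k l) z by apply/derivable1_diffP.
have dl l : differentiable (fun s => k l s *: delta_mx 0 l : 'rV[K]_m) z.
  exact: differentiableZl.
have ds : differentiable (\sum_(l < m) (fun s => k l s *: delta_mx 0 l : 'rV[K]_m)) z.
  exact: differentiable_sum.
split => //; rewrite -deriveE// derive_sum => [|l]; last exact: diff_derivable.
rewrite [RHS]row_sum_delta; apply: eq_bigr => l _.
by rewrite mxE deriveE// diffZl// -deriveE.
Qed.

(** A continuous linear map is its own differential; the linear structure of the coordinate is built
    on the spot. *)
Lemma diff_coord m n (i : 'I_m) (j : 'I_n) (A B : 'M[K]_(m, n)) :
  'd (fun N : 'M[K]_(m, n) => N i j) A B = B i j.
Proof.
have lin : linear (fun N : 'M[K]_(m, n) => N i j : K).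
  by move=> a M N; rewrite !mxE.
pose coordM := GRing.isLinear.Build _ _ _ _ _ lin.
pose f : {linear 'M[K]_(m, n) -> K} := HB.pack (fun N : 'M[K]_(m, n) => N i j) coordM.
by rewrite (_ : (fun N : 'M[K]_(m, n) => N i j) = f)// diff_lin//; exact: coord_continuous.
Qed.

Lemma is_derive_scale (a w : K) : is_derive w 1 (a \*o id) a.
Proof.
apply: DeriveDef; last by rewrite deriveMl ?derive_id ?mulr1.
by apply: (@derivableM _ _ (cst a) id).
Qed.

(** [a] and [c] are independent: in a Moebius transformation [a] is the conjugate of [c], which
    enters as a constant. *)
Lemma is_derive_homography (a c w : K) : 1 + a * w != 0 ->
  is_derive w 1 (fun s => (s + c) / (1 + a * s)) ((1 - c * a) / (1 + a * w) ^+ 2).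
Proof.
move=> Dw; pose N : K -> K := id + cst c.
pose D : K -> K := cst 1 + (a \*o id).
have [dN NE] : is_derive w 1 N (1 + 0) by exact: is_deriveD.
have [dD DE] : is_derive w 1 D (0 + a).
  by apply: is_deriveD; exact: is_derive_scale.
have dV : derivable (fun y => (D y)^-1) w 1 by exact: (@derivableV _ _ D).
have dM := derivableM dN dV.
apply: DeriveDef; first exact: dM.
have := deriveM dN dV; rewrite (@deriveV _ _ D)// NE DE add0r addr0.
rewrite -![_ *: _]/(_ * _) => ->.
rewrite -[N w]/(w + c) -[D w]/(1 + a * w).
by field.
Qed.

End chain_rule.

(** * Disc automorphisms and the Schwarz-Pick lemma at the origin *)

Section moebius.
Context {R : realType}.
Local Open Scope complex_scope.
Implicit Types c w z : R[i].

(** For [|c| < 1], the disc automorphism that sends 0 to [c] and has inverse [moebius (- c)]. *)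
Definition moebius c w : R[i] := (w + c) / (1 + c^* * w).

Lemma mulC_conj c : c * c^* = (cmod c ^+ 2)%:C.
Proof.
apply/eqP; case: c => a b; rewrite sqr_cmod eq_complex /=.
by apply/andP; split; apply/eqP; ring.
Qed.

Lemma cmod_conj c : cmod c^* = cmod c.
Proof. by case: c => a b /=; rewrite sqrrN. Qed.

Lemma moebius_denom_neq0 c w : cmod c < 1 -> cmod w < 1 -> 1 + c^* * w != 0.
Proof.
move=> c1 w1; apply/negP => /eqP/(congr1 (fun u => u - 1)).
rewrite addrC addKr sub0r => /(congr1 (@Normc.normc R)).
rewrite Normc.normcM cmod_conj normcN Normc.normc1 => /eqP; apply/negP.
rewrite lt_eqF// (le_lt_trans _ w1)// ler_piMl ?cmod_ge0// ltW//.
Qed.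

Lemma cmod_moebius_lt1 c w : cmod c < 1 -> cmod w < 1 -> cmod (moebius c w) < 1.
Proof.
move=> c1 w1; have d0 := moebius_denom_neq0 c1 w1.
have d0' : 0 < cmod (1 + c^* * w) by rewrite lt_def cmod_eq0 d0 cmod_ge0.
rewrite Normc.normcM Normc.normcV ltr_pdivrMr// mul1r.
rewrite -ltr_sqr ?qualifE/= ?cmod_ge0//.
rewrite -subr_gt0.
have -> : cmod (1 + c^* * w) ^+ 2 - cmod (w + c) ^+ 2 =
    (1 - cmod c ^+ 2) * (1 - cmod w ^+ 2).
  by rewrite !sqr_cmod; case: c {c1 d0 d0'} => a b; case: w {w1} => p q /=; ring.
by rewrite mulr_gt0// subr_gt0 expr_lt1// cmod_ge0.
Qed.

Lemma is_derive_moebius c w : cmod c < 1 -> cmod w < 1 ->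
  is_derive w 1 (moebius c) ((1 - c * c^*) / (1 + c^* * w) ^+ 2).
Proof.
move=> c1 w1; exact/is_derive_homography/moebius_denom_neq0.
Qed.

(** Schwarz's lemma applies to [moebius (- h 0) \o h], which fixes 0; the outer derivative at [h 0]
    is 1 / (1 - |h 0|^2). *)
Lemma schwarz_pick0 (h : R[i] -> R[i]) :
  (forall z, cmod z < 1 -> derivable h z 1) ->
  (forall z, cmod z < 1 -> cmod (h z) < 1) ->
  cmod ('D_1 h 0) <= 1 - cmod (h 0) ^+ 2.
Proof.
move=> dh h1; set b := h 0.
have z1 : cmod (0 : R[i]) < 1 by rewrite Normc.normc0.
have b1 : cmod (- b) < 1 by rewrite normcN h1.
pose dm w (w1 : cmod w < 1) := is_derive_moebius b1 w1.
have := @schwarz_derive0 R (moebius (- b) \o h).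
have [dm1 dm2] := dm b (h1 _ z1).
have dc := derive_comp (dh 0 z1) dm1.
rewrite dc -/b dm2 Normc.normcM.
have b2 : 0 < 1 - cmod b ^+ 2 by rewrite subr_gt0 expr_lt1 ?cmod_ge0// h1.
have -> : (1 - - b * (- b)^*) / (1 + (- b)^* * b) ^+ 2 = ((1 - cmod b ^+ 2)^-1)%:C.
  rewrite rmorphN mulrNN mulNr (mulrC _ b) mulC_conj -(rmorph1 (real_complex R)) -rmorphB.
  rewrite -rmorphXn -fmorph_div; congr _%:C; field; exact: lt0r_neq0.
rewrite cmodC ger0_norm ?invr_ge0 ?(ltW b2)// mulrC ler_pdivrMr// mul1r; apply.
- move=> z hz; apply: derivable_comp; first exact: dh.
  by have [] := dm _ (h1 _ hz).
- by move=> z hz; apply: cmod_moebius_lt1 => //; exact: h1.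
- by rewrite /= /moebius subrr mul0r.
Qed.

End moebius.

Section polydisc_schwarz_pick.
Context {R : realType}.
Local Open Scope complex_scope.

(** [M] is any positive bound on the normalised entries of [v], not their maximum, so that [v = 0]
    is covered. *)
Lemma polydisc_schwarz_pick m n (f : 'rV[R[i]]_m -> 'rV[R[i]]_n)
    (z v : 'rV[R[i]]_m) (M : R) (j : 'I_n) :
  holomorphic_polydisc_map f -> polydisc z -> 0 < M ->
  (forall l, cmod (v ord0 l) <= M * (1 - cmod (z ord0 l) ^+ 2)) ->
  cmod ('d f z v ord0 j) <= M * (1 - cmod (f z ord0 j) ^+ 2).
Proof.
move=> [fP fd] Pz M0 vM.
have zl l : 0 < 1 - cmod (z ord0 l) ^+ 2.
  by rewrite subr_gt0 expr_lt1 ?cmod_ge0//; exact: Pz.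
(* The Moebius factor has derivative 1 - |z^l|^2 at 0, so this slope gives phi'(0) = v / M; the
   bound on [v] makes it a contraction. *)
pose a l : R[i] := v ord0 l / (M * (1 - cmod (z ord0 l) ^+ 2))%:C.
have a1 l : cmod (a l) <= 1.
  rewrite Normc.normcM Normc.normcV cmodC ger0_norm; last first.
    by rewrite mulr_ge0// ltW.
  by rewrite ler_pdivrMr ?mulr_gt0// mul1r.
pose k l : R[i] -> R[i] := moebius (z ord0 l) \o (a l \*o id).
pose phi s : 'rV[R[i]]_m := \row_l k l s.
have as1 l (s : R[i]) : cmod s < 1 -> cmod (a l * s) < 1.
  by move=> s1; rewrite Normc.normcM (le_lt_trans _ s1)// ler_piMl ?cmod_ge0.
have da l (s : R[i]) : is_derive s 1 (a l \*o id) (a l).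
  exact: is_derive_scale.
have dk l (s : R[i]) : cmod s < 1 -> derivable (k l) s 1.
  move=> s1; apply: derivable_comp; first by have [] := da l s.
  by have [] := is_derive_moebius (Pz l) (as1 l s s1).
have phiP s : cmod s < 1 -> polydisc (phi s).
  by move=> s1 l; rewrite mxE; apply: cmod_moebius_lt1; [exact: Pz|exact: as1].
have c0 : cmod (0 : R[i]) < 1 by rewrite Normc.normc0.
have phi0 : phi 0 = z.
  apply/rowP => l; rewrite mxE /k /moebius /= mulr0 add0r mulr0 addr0 divr1.
  by [].
have dphi s : cmod s < 1 -> differentiable phi s.
  by move=> s1; have [] := @diff_row R[i] m k s (fun l => dk l s s1).
have dphi0 : 'd phi 0 1 = (M^-1)%:C *: v.
  have [_ ->] := @diff_row R[i] m k 0 (fun l => dk l 0 c0).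
  apply/rowP => l; rewrite !mxE.
  have [da1 da2] := da l 0.
  have a01 : cmod ((a l \*o id) 0) < 1 by exact: as1.
  have [dm1 dm2] := is_derive_moebius (Pz l) a01.
  have dc := derive_comp da1 dm1.
  rewrite dc dm2 da2 /= !mulr0 addr0 expr1n divr1 /a mulC_conj.
  rewrite -(rmorph1 (real_complex R)) -rmorphB mulrCA -fmorph_div mulrC.
  congr (_%:C * _); field; rewrite lt0r_neq0//= lt0r_neq0//.
pose h : R[i] -> R[i] := (fun N : 'rV[R[i]]_n => N ord0 j) \o (f \o phi).
have dfphi s : cmod s < 1 -> differentiable (f \o phi) s.
  by move=> s1; apply: differentiable_comp; [exact: dphi|exact/fd/phiP].
have dh s : cmod s < 1 -> differentiable h s.
  move=> s1; apply: differentiable_comp; first exact: dfphi.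
  exact: differentiable_coord.
have := @schwarz_pick0 R h.
have dfz : differentiable f (phi 0) by rewrite phi0; exact: fd.
have dh0 : 'D_1 h 0 = (M^-1)%:C * 'd f z v ord0 j.
  rewrite (deriveE _ (dh 0 c0)).
  rewrite (diff_comp (dfphi 0 c0) (differentiable_coord _ _ _)).
  rewrite (diff_comp (dphi 0 c0) dfz).
  by rewrite /= diff_coord phi0 dphi0 linearZ mxE.
rewrite dh0.
have -> : h 0 = f z ord0 j by rewrite /h /= phi0.
rewrite Normc.normcM cmodC.
rewrite ger0_norm ?invr_ge0 ?(ltW M0)// ler_pdivrMl//; apply.
- by move=> s s1; apply/derivable1_diffP; exact: dh.
- by move=> s s1; apply: fP; exact: phiP.
Qed.

End polydisc_schwarz_pick.

(** * Optimal constant for the polydisc metrics *)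

Section metric.
Context {R : realType}.
Local Open Scope complex_scope.

Lemma kth_rootX k (x : R) : (0 < k)%N -> 0 <= x -> kth_root k (x ^+ k) = x.
Proof.
move=> k0 x0; rewrite /kth_root -powR_mulrn// -powRrM divff ?powRr1//.
by rewrite pnatr_eq0 -lt0n.
Qed.

Lemma kth_rootM k (x y : R) : 0 <= x -> 0 <= y ->
  kth_root k (x * y) = kth_root k x * kth_root k y.
Proof. exact: powRM. Qed.

Lemma ler_kth_root k (x y : R) : 0 <= x -> x <= y -> kth_root k x <= kth_root k y.
Proof.
move=> x0 xy; apply: ge0_ler_powR => //; rewrite ?invr_ge0 ?nnegrE//.
exact: le_trans xy.
Qed.

Variables (d : nat) (t : R) (k : nat).
Hypotheses (t0 : 0 <= t) (k0 : (0 < k)%N).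
Implicit Types z v : 'rV[R[i]]_d.

(** The Poincaré length of the l-th component of [v]. *)
Let b z v l := cmod (v ord0 l) / (1 - cmod (z ord0 l) ^+ 2).

(** Powers [2 * k] become k-th powers of squares, ready for [kth_rootX]. *)
Lemma polydisc_metric_sqr z v : polydisc_metric t k z v ^+ 2 =
  (\sum_(l < d) b z v l ^+ 2 +
   t * kth_root k (\sum_(l < d) (b z v l ^+ 2) ^+ k)) / (1 + t).
Proof.
have t1 : 0 <= 1 + t by rewrite addr_ge0.
rewrite /polydisc_metric exprMn exprVn !sqr_sqrtr//; last first.
  rewrite addr_ge0 ?sumr_ge0// => [l _|]; last by rewrite mulr_ge0// powR_ge0.
  by rewrite divr_ge0// sqr_ge0.
rewrite mulrC; congr ((_ + t * kth_root k _) / _); apply: eq_bigr => l _.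
  by rewrite /b expr_div_n.
by rewrite -exprM /b expr_div_n.
Qed.

(** Keeping only the l-th term of both sums leaves [(1 + t) b ^ 2], and the factor [1 + t]
    cancels. *)
Lemma polydisc_metric_ge z v l : polydisc z ->
  cmod (v ord0 l) / (1 - cmod (z ord0 l) ^+ 2) <= polydisc_metric t k z v.
Proof.
move=> Pz.
have b0 i : 0 <= b z v i.
  by rewrite divr_ge0 ?cmod_ge0// subr_ge0 expr_le1 ?cmod_ge0// ltW// Pz.
have m0 : 0 <= polydisc_metric t k z v.
  by rewrite mulr_ge0 ?invr_ge0 ?sqrtr_ge0.
rewrite -/(b z v l) -ler_sqr ?nnegrE ?b0// polydisc_metric_sqr.
rewrite ler_pdivlMr ?ltr_pwDl// mulrDr mulr1 mulrC.
have le_sum (g : 'I_d -> R) : (forall i, 0 <= g i) -> g l <= \sum_(i < d) g i.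
  by move=> g0; rewrite (bigD1 l)//= lerDl sumr_ge0.
apply: lerD; first by apply: le_sum => i; exact: sqr_ge0.
rewrite ler_wpM2l// -[leLHS](kth_rootX k0) ?sqr_ge0// ler_kth_root//.
  by rewrite exprn_ge0// sqr_ge0.
by apply: (le_sum (fun i => (b z v i ^+ 2) ^+ k)) => i; rewrite exprn_ge0// sqr_ge0.
Qed.

(** The sums are at most [d M ^ 2] and [d (M ^ 2) ^ k], and the k-th root of the latter splits into
    that of [d] times [M ^ 2]. *)
Lemma polydisc_metric_le z v (M : R) : polydisc z ->
  (forall l, cmod (v ord0 l) <= M * (1 - cmod (z ord0 l) ^+ 2)) -> 0 <= M ->
  polydisc_metric t k z v ^+ 2 <=
    (d%:R + t * kth_root k d%:R) / (1 + t) * M ^+ 2.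
Proof.
move=> Pz vM M0.
have zl l : 0 < 1 - cmod (z ord0 l) ^+ 2.
  by rewrite subr_gt0 expr_lt1 ?cmod_ge0//; exact: Pz.
have bM l : b z v l ^+ 2 <= M ^+ 2.
  have b0 : 0 <= b z v l by rewrite divr_ge0 ?cmod_ge0// ltW.
  by rewrite lerXn2r ?nnegrE// /b ler_pdivrMr.
rewrite polydisc_metric_sqr mulrAC ler_wpM2r ?invr_ge0 ?addr_ge0//.
have sum_le (g : 'I_d -> R) c : (forall i, g i <= c) -> \sum_(i < d) g i <= d%:R * c.
  move=> gc; rewrite mulr_natl -[X in c *+ X]card_ord -sumr_const.
  by apply: ler_sum => i _; exact: gc.
rewrite mulrDl; apply: lerD; first exact: sum_le.
rewrite -mulrA ler_wpM2l// -{1}[M ^+ 2](kth_rootX k0) ?sqr_ge0//.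
rewrite -kth_rootM ?exprn_ge0 ?sqr_ge0//.
apply: ler_kth_root.
  by apply: sumr_ge0 => i _; rewrite exprn_ge0// sqr_ge0.
by apply: sum_le => i; rewrite lerXn2r ?nnegrE ?sqr_ge0.
Qed.

End metric.

(** * The upper bound and its sharpness *)

Section bound.
Context {R : realType}.
Local Open Scope complex_scope.

(** The source metric itself serves as [M], since it dominates every normalised entry of [v]. *)
Lemma schwarz_bound_polydisc m n (t t' : R) k k' : 0 <= t -> 0 <= t' ->
  (0 < k)%N -> (0 < k')%N ->
  schwarz_bound m n t t' k k' ((n%:R + t' * kth_root k' n%:R) / (1 + t')).
Proof.
move=> t0 t'0 k0 k'0 f hf z v Pz; have Pfz : polydisc (f z) by apply: hf.1.
have M0 : 0 <= polydisc_metric t k z v.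
  by rewrite mulr_ge0 ?invr_ge0 ?sqrtr_ge0.
apply: polydisc_metric_le => // j.
have fzj : 0 < 1 - cmod (f z ord0 j) ^+ 2.
  by rewrite subr_gt0 expr_lt1 ?cmod_ge0//; exact: Pfz.
(* The metric vanishes at [v = 0] while the component bound asks for a positive [M], hence the added
   [e]. *)
rewrite -ler_pdivrMr//; apply/ler_addgt0Pr => e e0; rewrite ler_pdivrMr//.
apply: polydisc_schwarz_pick => //; first by rewrite ltr_wpDl.
move=> l; have zl : 0 < 1 - cmod (z ord0 l) ^+ 2.
  by rewrite subr_gt0 expr_lt1 ?cmod_ge0//; exact: Pz.
rewrite -ler_pdivrMr// (le_trans (polydisc_metric_ge t0 k0 v l Pz))//.
by rewrite lerDl ltW.
Qed.

(** For the diagonal map at the origin, the image of the first basis vector has all entries 1 and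
    the source metric is 1, so the inequality reads off the constant. *)
Lemma schwarz_bound_ge m n (t t' c : R) k k' : (0 < m)%N ->
  0 <= t -> 0 <= t' -> (0 < k)%N -> (0 < k')%N ->
  schwarz_bound m n t t' k k' c ->
  (n%:R + t' * kth_root k' n%:R) / (1 + t') <= c.
Proof.
move=> m0 t0 t'0 k0 k'0; pose i0 := Ordinal m0.
pose f (z : 'rV[R[i]]_m) : 'rV[R[i]]_n := z ord0 i0 *: const_mx 1.
have dcoord (z : 'rV[R[i]]_m) : differentiable (fun N : 'rV[R[i]]_m => N ord0 i0) z.
  exact: differentiable_coord.
have hf : holomorphic_polydisc_map f.
  split=> z Pz; last exact: differentiableZl.
  by move=> j; rewrite !mxE mulr1; exact: Pz.
have P0 : polydisc (0 : 'rV[R[i]]_m).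
  by move=> l; rewrite mxE Normc.normc0.
have b0 d (v : 'rV[R[i]]_d) l :
    cmod (v ord0 l) / (1 - cmod ((0 : 'rV[R[i]]_d) ord0 l) ^+ 2) = cmod (v ord0 l).
  by rewrite mxE Normc.normc0 expr0n subr0 divr1.
move=> /(_ f hf 0 (delta_mx ord0 i0) P0); rewrite /pullback.
have -> : f 0 = 0 by rewrite /f mxE scale0r.
have -> : 'd f 0 (delta_mx ord0 i0) = const_mx 1.
  by rewrite diffZl// diff_coord mxE !eqxx scale1r.
rewrite !polydisc_metric_sqr//.
have -> : \sum_(l < n) (cmod ((const_mx 1 : 'rV[R[i]]_n) ord0 l) /
   (1 - cmod ((0 : 'rV[R[i]]_n) ord0 l) ^+ 2)) ^+ 2 = n%:R.
  under eq_bigr do rewrite b0 mxE Normc.normc1 expr1n.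
  by rewrite sumr_const card_ord.
have -> : \sum_(l < n) ((cmod ((const_mx 1 : 'rV[R[i]]_n) ord0 l) /
   (1 - cmod ((0 : 'rV[R[i]]_n) ord0 l) ^+ 2)) ^+ 2) ^+ k' = n%:R.
  under eq_bigr do rewrite b0 mxE Normc.normc1 !expr1n.
  by rewrite sumr_const card_ord.
(* Used with [p = 1] and [p = k] for the two source sums; for [p = 0] the zero entries would
   contribute 0^0 = 1. *)
have sum_delta p : (0 < p)%N -> \sum_(l < m) ((cmod ((delta_mx ord0 i0 : 'rV[R[i]]_m) ord0 l) /
   (1 - cmod ((0 : 'rV[R[i]]_m) ord0 l) ^+ 2)) ^+ 2) ^+ p = 1.
  move=> p0; rewrite (bigD1 i0)//= b0 mxE !eqxx Normc.normc1 !expr1n.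
  rewrite big1 ?addr0// => l li; rewrite b0 mxE eqxx (negPf li) Normc.normc0.
  by rewrite !expr0n /= eqn0Ngt p0.
have := sum_delta 1%N isT; under eq_bigr do rewrite expr1.
have root1 : kth_root k 1 = 1 :> R by rewrite -[X in kth_root _ X](expr1n R k) kth_rootX.
move=> ->; rewrite sum_delta// root1 mulr1 divff ?mulr1//.
by rewrite gt_eqF// ltr_pwDl.
Qed.

End bound.

Theorem theorem1p2 (R : realType) (m n : nat) (t t' : R) (k k' : nat)
    (hm : (2 <= m)%N) (hn : (2 <= n)%N) (ht : 0 <= t) (ht' : 0 <= t')
    (hk : (2 <= k)%N) (hk' : (2 <= k')%N) :
  schwarz_bound m n t t' k k'
    ((n%:R + t' * kth_root k' n%:R) / (1 + t')) /\
  (forall c : R, c < (n%:R + t' * kth_root k' n%:R) / (1 + t') ->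
     ~ schwarz_bound m n t t' k k' c).
Proof.
have [m0 k0 k'0] := And3 (ltnW hm) (ltnW hk) (ltnW hk').
split; first exact: schwarz_bound_polydisc.
move=> c cn sb; move: cn; rewrite ltNge => /negP; apply.
exact: schwarz_bound_ge sb.
Qed.
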